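(* Let $m\ge3$ be an integer. For every $Q\in X_2^m$, the associated form $\mathbf{Q}\in\mathcal{Q}_2^{2(m-2)}$ satisfies $\mathrm{Cat}(\mathbf{Q})\ne 0$.
   Context: $\mathcal{Q}_2^m$ is the complex vector space of binary forms (homogeneous polynomials) of degree $m$ on $\mathbb{C}^2$. $X_2^m$ ($m\ge3$) is the set of $Q\in\mathcal{Q}_2^m$ with non-zero discriminant, i.e. such that the partial derivatives $Q_1=\partial Q/\partial z_1$, $Q_2=\partial Q/\partial z_2$ have no common zero in $\mathbb{C}^2\setminus\{0\}$. Associated form: for $Q\in X_2^m$ let $M(Q):=\mathbb{C}[z_1,z_2]/(Q_1,Q_2)$ (the Milnor algebra). It is a local Artinian Gorenstein algebra; with $\mathfrak{m}$ its maximal ideal, $\mathrm{Soc}(M(Q)):=\{x\in\mathfrak{m}:x\mathfrak{m}=0\}$ is one-dimensional, equals $\mathfrak{m}^{2(m-2)}$, and is spanned by the element $e_0$ represented by the Hessian determinant $\mathrm{Hess}(Q)=\det(\partial^2Q/\partial z_i\partial z_j)$. Let $\omega:\mathrm{Soc}(M(Q))\to\mathbb{C}$ be the linear isomorphism with $\omega(e_0)=1$, and let $e_j$ be the element of $M(Q)$ represented by $z_j$. The associated form of $Q$ is $\mathbf{Q}\in\mathcal{Q}_2^{2(m-2)}$, $\mathbf{Q}(z):=\omega\left((z_1e_1+z_2e_2)^{2(m-2)}\right)$ for $z=(z_1,z_2)\in\mathbb{C}^2$. Catalecticant: for a binary form $P(z)=\sum_{j=0}^{2N}\binom{2N}{j}a_jz_1^{2N-j}z_2^j$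 of even degree $2N$, $\mathrm{Cat}(P):=\det(a_{i+j})_{0\le i,j\le N}$. *)

(* Defs.v *)
From HB Require Import structures.
From mathcomp Require Import all_boot all_order all_algebra.
From mathcomp Require Import boolp classical_sets functions reals.
From mathcomp Require Import complex.
From mathcomp Require Import mpoly.

Set Implicit Arguments.
Unset Strict Implicit.
Unset Printing Implicit Defensive.

Import Order.TTheory GRing.Theory Num.Theory.
Import Quotient.

Local Open Scope ring_scope.
Local Open Scope quotient_scope.
Local Open Scope complex_scope.

Section CommutativeAlgebra.
Variable A : comPzRingType.

Definition is_ideal (I : set A) : Prop :=
  [/\ I 0, forall x y, I x -> I y -> I (x + y) & forall a x, I x -> I (a * x)].

Definition is_maximal_ideal (I : set A) : Prop :=
  [/\ is_ideal I, I <> setT &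
      forall J : set A, is_ideal J -> (I `<=` J)%classic -> J = I \/ J = setT].

(* Only meant for a local ring, where the maximal ideal is unique; in general
   this picks some maximal ideal, or the empty set if there is none. *)
Definition maximal_ideal : set A := xget set0 is_maximal_ideal.

Definition socle : set A :=
  [set x | maximal_ideal x /\ forall y, maximal_ideal y -> x * y = 0]%classic.

End CommutativeAlgebra.

Section BinaryForms.
Variable R : realType.
Local Notation C := R[i].
Local Notation poly2 := {mpoly C[2]}.

Definition nondegenerate_form (m : nat) (Q : poly2) : Prop :=
  Q \is m.-homog /\
  forall z : 'I_2 -> C, (forall i, (Q^`M(i)).@[z] = 0) -> forall i, z i = 0.

Definition hessian (Q : poly2) : poly2 :=
  \det (\matrix_(i < 2, j < 2) Q^`M(i)^`M(j)).

Definition jacobian_ideal (Q : poly2) : poly2 -> bool :=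
  fun p => `[< exists u : 'I_2 -> poly2, p = \sum_(i < 2) u i * Q^`M(i) >].

Lemma jacobian_ideal_zmod_closed Q : zmod_closed (jacobian_ideal Q).
Proof.
split=> [|p q /asboolP[u ->] /asboolP[v ->]]; apply/asboolP.
  by exists (fun=> 0); rewrite big1 // => i _; rewrite mul0r.
exists (fun i => u i - v i); rewrite -sumrB.
by apply: eq_bigr => i _; rewrite mulrBl.
Qed.

HB.instance Definition _ Q :=
  GRing.isZmodClosed.Build poly2 (jacobian_ideal Q)
    (jacobian_ideal_zmod_closed Q).

Lemma jacobian_idealMl Q a p :
  p \in jacobian_ideal Q -> a * p \in jacobian_ideal Q.
Proof.
move=> /asboolP[u ->]; apply/asboolP; exists (fun i => a * u i).
by rewrite mulr_sumr; apply: eq_bigr => i _; rewrite mulrA.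
Qed.

(* The library's ring structure on [{ideal_quot I}] requires [I] to be proper.
   Here the additive quotient is given a possibly trivial ring structure, so
   that the Milnor algebra is defined for every polynomial. *)
Definition milnor (Q : poly2) : Type :=
  {quot (GRing.ZmodClosed.clone poly2 (jacobian_ideal Q) _)}.

HB.instance Definition _ Q := GRing.Zmodule.on (milnor Q).
HB.instance Definition _ Q := EqQuotient.on (milnor Q).

Section MilnorAlgebra.
Variable Q : poly2.

Definition milnor_pi (p : poly2) : milnor Q := \pi_(milnor Q) p.

Definition milnor_mul (x y : milnor Q) : milnor Q :=
  milnor_pi (repr x * repr y).

Definition milnor_scale (c : C) (x : milnor Q) : milnor Q :=
  milnor_pi (c *: repr x).

Lemma milnor_reprK (x : milnor Q) : milnor_pi (repr x) = x.
Proof. exact: reprK. Qed.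

Lemma milnor_piP p q : milnor_pi p = milnor_pi q <-> p - q \in jacobian_ideal Q.
Proof.
by rewrite (idealrBE (GRing.ZmodClosed.clone poly2 (jacobian_ideal Q) _)); split=> [h|/eqP//]; apply/eqP.
Qed.

Lemma milnor_piD : {morph milnor_pi : p q / p + q}.
Proof. by move=> p q; exact: (@raddfD _ _ \pi_{quot (GRing.ZmodClosed.clone poly2 (jacobian_ideal Q) _)}). Qed.

Lemma milnor_piM p q : milnor_mul (milnor_pi p) (milnor_pi q) = milnor_pi (p * q).
Proof.
apply/milnor_piP.
set p' := repr _; set q' := repr _.
have hp : p' - p \in jacobian_ideal Q by apply/milnor_piP/milnor_reprK.
have hq : q' - q \in jacobian_ideal Q by apply/milnor_piP/milnor_reprK.
have -> : p' * q' - p * q = p' * (q' - q) + q * (p' - p).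
  by rewrite !mulrBr [q * p']mulrC [q * p]mulrC addrA subrK.
by rewrite rpredD ?jacobian_idealMl.
Qed.

Lemma milnor_piZ c p : milnor_scale c (milnor_pi p) = milnor_pi (c *: p).
Proof.
apply/milnor_piP; rewrite -scalerBr -mul_mpolyC jacobian_idealMl //.
exact/milnor_piP/milnor_reprK.
Qed.

Lemma milnor_mulA : associative milnor_mul.
Proof.
move=> x y z; rewrite -(milnor_reprK x) -(milnor_reprK y) -(milnor_reprK z).
by rewrite !milnor_piM mulrA.
Qed.

Lemma milnor_mulC : commutative milnor_mul.
Proof. by move=> x y; rewrite /milnor_mul mulrC. Qed.

Lemma milnor_mul1 : left_id (milnor_pi 1) milnor_mul.
Proof. by move=> x; rewrite -(milnor_reprK x) milnor_piM mul1r. Qed.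

Lemma milnor_mulDl : left_distributive milnor_mul +%R.
Proof.
move=> x y z; rewrite -(milnor_reprK x) -(milnor_reprK y) -(milnor_reprK z).
by rewrite -milnor_piD !milnor_piM -milnor_piD mulrDl.
Qed.

HB.instance Definition _ := GRing.Zmodule_isComPzRing.Build (milnor Q)
  milnor_mulA milnor_mulC milnor_mul1 milnor_mulDl.

Lemma milnor_scaleA c d x :
  milnor_scale c (milnor_scale d x) = milnor_scale (c * d) x.
Proof. by rewrite -(milnor_reprK x) !milnor_piZ scalerA. Qed.

Lemma milnor_scale1 : left_id 1 milnor_scale.
Proof. by move=> x; rewrite -(milnor_reprK x) milnor_piZ scale1r. Qed.

Lemma milnor_scaleDr : right_distributive milnor_scale +%R.
Proof.
move=> c x y; rewrite -(milnor_reprK x) -(milnor_reprK y).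
by rewrite -milnor_piD !milnor_piZ -milnor_piD scalerDr.
Qed.

Lemma milnor_scaleDl x : {morph milnor_scale^~ x : c d / c + d}.
Proof.
by move=> c d; rewrite -(milnor_reprK x) !milnor_piZ -milnor_piD scalerDl.
Qed.

HB.instance Definition _ := GRing.Zmodule_isLmodule.Build C (milnor Q)
  milnor_scaleA milnor_scale1 milnor_scaleDr milnor_scaleDl.

(* Only the values of [w] on the socle are constrained. *)
Definition is_socle_iso (w : milnor Q -> C) : Prop :=
  [/\ forall (c : C) (x y : milnor Q), socle x -> socle y -> w (c *: x + y) = c * w x + w y,
      set_bij (@socle (milnor Q)) setT w &
      w (milnor_pi (hessian Q)) = 1].

Definition socle_iso : milnor Q -> C := xget (fun=> 0) is_socle_iso.

End MilnorAlgebra.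

Definition is_associated_form (m : nat) (Q P : poly2) : Prop :=
  P \is (2 * (m - 2)).-homog /\
  forall z : 'I_2 -> C,
    P.@[z] =
    @socle_iso Q ((\sum_(i < 2) z i *: milnor_pi Q 'X_i) ^+ (2 * (m - 2))).

(* For nondegenerate [Q] of degree [m >= 3] exactly one polynomial satisfies
   [is_associated_form m Q]. If there were none, the value would be [0], whose
   catalecticant vanishes. *)
Definition associated_form (m : nat) (Q : poly2) : poly2 :=
  xget 0 (is_associated_form m Q).

Definition catalecticant (N : nat) (P : poly2) : C :=
  let a j := P@_(U_(ord0) *+ (2 * N - j) + U_(ord_max) *+ j)%MM
             / 'C(2 * N, j)%:R in
  \det (\matrix_(i < N.+1, j < N.+1) a (i + j)%N).

End BinaryForms.

(* Main.v *)
(* Write F = Q_1, G = Q_2, forms of degree d = m - 1 without common zero, and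
   J = (F, G).  A univariate Bezout relation, homogenized, puts powers of both
   variables in J, whence the syzygies of (F, G) are the trivial ones.  If x p
   and y p lie in J, comparing the two expressions gives a syzygy, and after
   substituting Euler's relations for F and G it shows that p is congruent
   modulo J to a scalar multiple of the Hessian, whose degree is 2(m - 2).  Thus
   a form p of any other degree with x p, y p in J already lies in J.  Applied
   repeatedly, this puts all forms of degree > 2(m - 2) in J and makes the
   multiplication pairing in degrees (m - 2, m - 2), with values in the socle,
   nondegenerate.  The catalecticant of the associated form is the Gram
   determinant of that pairing on monomials, and forms of degree m - 2 < d
   are nonzero modulo J. *)
From HB Require Import structures.
Require Import Defs.
From mathcomp Require Import all_boot all_order all_algebra.
From mathcomp Require Import boolp classical_sets functions reals complex mpoly.
From mathcomp Require Import ring zify.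
Set Implicit Arguments.
Unset Strict Implicit.
Unset Printing Implicit Defensive.
Import GRing.Theory Num.Theory.
Local Open Scope ring_scope.

(** * Induction on polynomials, and case analysis on two indices *)

Lemma mpoly_mulX_ind (n : nat) (R : nzRingType) (P : {mpoly R[n]} -> Prop) :
  (forall c, P c%:MP) -> (forall p q, P p -> P q -> P (p + q)) ->
  (forall i p, P p -> P ('X_i * p)) -> forall p, P p.
Proof.
move=> PC PD PX; elim/mpolyind => [|c m p _ _ Pp]; first by rewrite -mpolyC0.
apply: PD => //; rewrite -mul_mpolyC commr_mpolyX mpolyXE_id.
elim: (index_enum _) => [|i s IHs]; first by rewrite big_nil mul1r.
rewrite big_cons; elim: (m i) => [|k IHk]; first by rewrite expr0 mul1r.
by rewrite exprS -!mulrA; apply: PX; rewrite mulrA.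
Qed.

Lemma ord2_cases (i j k : 'I_2) : i != j -> k = i \/ k = j.
Proof.
by case: i j k => [[|[|i]] ?] [[|[|j]] ?] [[|[|k]] ?] //= _;
   first [left; exact: val_inj | right; exact: val_inj].
Qed.

Lemma big_ord2 (T : Type) (idx : T) (op : Monoid.law idx) (f : 'I_2 -> T) :
  \big[op/idx]_(i < 2) f i = op (f ord0) (f ord_max).
Proof.
by rewrite !big_ord_recl big_ord0 Monoid.mulm1; congr (op _ (f _)); apply: val_inj.
Qed.

Lemma big_ord2_neq (T : Type) (idx : T) (op : Monoid.com_law idx) (i j : 'I_2)
    (f : 'I_2 -> T) :
  i != j -> \big[op/idx]_(k < 2) f k = op (f i) (f j).
Proof.
rewrite big_ord2 => nij.
have: i = ord0 /\ j = ord_max \/ i = ord_max /\ j = ord0.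
  by case: i j nij => [[|[|i]] ?] [[|[|j]] ?] //= _;
    [left|right]; split; apply: val_inj.
by case=> -[-> ->] //; rewrite Monoid.mulmC.
Qed.

(** * Restriction to an axis, dehomogenization and coefficients of binary forms *)

Section BivariateRing.
Variable R : comNzRingType.
Local Notation poly2 := {mpoly R[2]}.

Definition restrict_axis (i : 'I_2) (p : poly2) : {poly R} :=
  mmap (@polyC R) (fun k => if k == i then 0 else 'X) p.

HB.instance Definition _ i := GRing.RMorphism.copy (restrict_axis i)
  (mmap (@polyC R) (fun k : 'I_2 => if k == i then 0 else 'X)).

Lemma restrict_axisC i c : restrict_axis i c%:MP = c%:P.
Proof. exact: mmapC. Qed.

Lemma restrict_axisX i j : restrict_axis i 'X_j = if j == i then 0 else 'X.
Proof. by rewrite /restrict_axis mmapX mmap1U. Qed.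

(** Division by ['X_i]: the remainder is the restriction of [p] to the line where ['X_i] vanishes.
    It follows that the kernel of [restrict_axis i] is generated by ['X_i]. *)
Lemma restrict_axisE (i j : 'I_2) (p : poly2) : i != j ->
  exists q, p = 'X_i * q + (map_poly (@mpolyC 2 R) (restrict_axis i p)).['X_j].
Proof.
move=> nij; elim/mpoly_mulX_ind: p => [c|p q [p' Ep] [q' Eq]|k p [p' Ep]].
- by exists 0; rewrite mulr0 add0r restrict_axisC map_polyC hornerC.
- exists (p' + q'); rewrite rmorphD rmorphD hornerD {1}Ep {1}Eq; ring.
have [->|->] := ord2_cases k nij; rewrite rmorphM /= restrict_axisX.
  by exists p; rewrite eqxx mul0r rmorph0 horner0 addr0.
exists ('X_j * p'); rewrite eq_sym (negPf nij) rmorphM /= map_polyX.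
by rewrite hornerM hornerX {1}Ep; ring.
Qed.

Lemma restrict_axis_eq0 (i : 'I_2) (p : poly2) :
  restrict_axis i p = 0 -> exists q, p = 'X_i * q.
Proof.
move=> p0; have [|q] := @restrict_axisE i (rev_ord i) p.
  by case: i {p0} => [[|[|]]].
by rewrite p0 rmorph0 horner0 addr0 => ->; exists q.
Qed.

Lemma mpoly2_constE (p : poly2) :
  exists a b, p = (p@_0%MM)%:MP + 'X_ord0 * a + 'X_ord_max * b.
Proof.
suff [c [a [b Ep]]]: exists c a b, p = c%:MP + 'X_ord0 * a + 'X_ord_max * b.
  exists a, b; rewrite {1}Ep; congr (_%:MP + _ + _).
  have H (i : 'I_2) (q : poly2): ('X_i * q)@_0%MM = 0.
    by rewrite rmorphM /= mcoeffX mnm1_eq0 mul0r.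
  by rewrite Ep !mcoeffD !H mcoeffC eqxx mulr1 !addr0.
elim/mpoly_mulX_ind: p => [c|p q [c [a [b Ep]]] [c' [a' [b' Eq]]]|k p _].
- by exists c, 0, 0; rewrite !mulr0 !addr0.
- exists (c + c'), (a + a'), (b + b'); rewrite Ep Eq mpolyCD; ring.
have [->|->] := @ord2_cases ord0 ord_max k isT.
  by exists 0, p, 0; rewrite mpolyC0; ring.
by exists 0, 0, p; rewrite mpolyC0; ring.
Qed.

Definition dehomogenize (i : 'I_2) (p : poly2) : {poly R} :=
  mmap (@polyC R) (fun k => if k == i then 'X else 1) p.

HB.instance Definition _ i := GRing.RMorphism.copy (dehomogenize i)
  (mmap (@polyC R) (fun k : 'I_2 => if k == i then 'X else 1)).

Lemma dehomogenizeC i c : dehomogenize i c%:MP = c%:P.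
Proof. exact: mmapC. Qed.

Lemma dehomogenizeX i j : dehomogenize i 'X_j = if j == i then 'X else 1.
Proof. by rewrite /dehomogenize mmapX mmap1U. Qed.

Lemma horner_dehomogenize i (p : poly2) (t : R) :
  (dehomogenize i p).[t] = p.@[fun k => if k == i then t else 1].
Proof.
elim/mpoly_mulX_ind: p => [c|p q Ep Eq|k p Ep].
- by rewrite dehomogenizeC hornerC mevalC.
- by rewrite rmorphD hornerD mevalD Ep Eq.
rewrite rmorphM hornerM mevalM mevalXU /= Ep dehomogenizeX.
by case: ifP; rewrite ?hornerX ?hornerC.
Qed.

(** In a fixed total degree the exponent of ['X_i] determines the monomial, so no two terms of a
    form merge when the other variable is set to 1. *)
Lemma dehomogenize_eq0 i n (p : poly2) :
  p \is n.-homog -> dehomogenize i p = 0 -> p = 0.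
Proof.
move=> /dhomogP homp p0; apply/mpolyP => m0; rewrite mcoeff0.
apply/eqP; rewrite mcoeff_eq0; apply/negP => m0p.
have [j nij] : exists j, i != j.
  by exists (rev_ord i); case: i {p0} => [[|[|]]].
have E m : mmap1 (fun k : 'I_2 => if k == i then 'X else 1 : {poly R}) m = 'X^(m i).
  rewrite /mmap1 (big_ord2_neq _ _ nij) /= eqxx eq_sym (negPf nij).
  by rewrite expr1n mulr1.
have: (dehomogenize i p)`_(m0 i) = p@_m0.
  rewrite /dehomogenize /mmap coef_sum (bigD1_seq m0) ?msupp_uniq //= E.
  rewrite coefCM coefXn eqxx mulr1 big_seq_cond big1 ?addr0 // => m /andP[mp nm].
  rewrite E coefCM coefXn; case: eqP => [e|]; last by rewrite mulr0.
  case/eqP: nm; apply/mnmP => k.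
  have := homp m mp; rewrite -(homp m0 m0p) /= !mdegE.
  rewrite !(big_ord2_neq _ _ nij) /= e => /addnI ej.
  by have [->|->] := ord2_cases k nij.
by rewrite p0 coef0 => /esym/eqP; rewrite mcoeff_eq0 m0p.
Qed.

Lemma dhomogXn (i : 'I_2) k : ('X_i ^+ k : poly2) \is k.-homog.
Proof. by rewrite mpolyXn dhomogX /= mdegMn mdeg1 mul1n. Qed.

Lemma dhomog_XY n j : (j <= n)%N ->
  ('X_ord0 ^+ (n - j) * 'X_ord_max ^+ j : poly2) \is n.-homog.
Proof.
by move=> le_jn; have := dhomogM (dhomogXn ord0 (n - j)) (dhomogXn ord_max j);
  rewrite subnK.
Qed.

Lemma mcoeff_XY n a b k : (k <= n)%N -> (b <= n)%N -> a = (n - b)%N ->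
  ('X_ord0 ^+ (n - k) * 'X_ord_max ^+ k : poly2)
    @_(U_(ord0) *+ a + U_(ord_max) *+ b) = (k == b)%:R.
Proof.
move=> lekn lebn ->; rewrite !mpolyXn -mpolyXD mcoeffX; congr (nat_of_bool _)%:R.
apply/eqP/eqP => [/mnmP/(_ ord_max)|-> //].
by rewrite !mnmDE !mulmnE !mnm1E /= !mul1n !mul0n.
Qed.

Lemma mcoeff_sumXY n (f : nat -> R) b : (b <= n)%N ->
  (\sum_(k < n.+1) f k *: ('X_ord0 ^+ (n - k) * 'X_ord_max ^+ k) : poly2)
    @_(U_(ord0) *+ (n - b) + U_(ord_max) *+ b) = f b.
Proof.
move=> lebn; rewrite raddf_sum /= (bigD1 (Ordinal (lebn : b < n.+1)%N)) //=.
rewrite mcoeffZ mcoeff_XY // eqxx mulr1 big1 ?addr0 // => k nk.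
rewrite mcoeffZ mcoeff_XY ?leq_ord //.
suff /negPf -> : (k : nat) != b by rewrite mulr0.
by apply: contraNneq nk => kb; apply/eqP/val_inj.
Qed.

End BivariateRing.

(** * Ideals with two generators *)

Definition ideal2 (A : comNzRingType) (f g p : A) : Prop :=
  exists a b, p = a * f + b * g.

Section Ideal2.
Variables (A : comNzRingType) (f g : A).

Lemma ideal2_0 : ideal2 f g 0.
Proof. by exists 0, 0; rewrite !mul0r addr0. Qed.

Lemma ideal2D p q : ideal2 f g p -> ideal2 f g q -> ideal2 f g (p + q).
Proof. by move=> [a [b ->]] [c [e ->]]; exists (a + c), (b + e); ring. Qed.

Lemma ideal2Ml q p : ideal2 f g p -> ideal2 f g (q * p).
Proof. by move=> [a [b ->]]; exists (q * a), (q * b); ring. Qed.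

Lemma ideal2Mr q p : ideal2 f g p -> ideal2 f g (p * q).
Proof. by rewrite mulrC; apply: ideal2Ml. Qed.

Lemma ideal2_sum (I : Type) (r : seq I) (P : pred I) (h : I -> A) :
  (forall i, P i -> ideal2 f g (h i)) -> ideal2 f g (\sum_(i <- r | P i) h i).
Proof. by move=> Ih; apply: big_ind => //; [apply: ideal2_0 | apply: ideal2D]. Qed.

End Ideal2.

(** * Coprime binary forms over an algebraically closed field and their syzygies *)

Section BivariateField.
Variable C : closedFieldType.
Local Notation poly2 := {mpoly C[2]}.

Lemma mpolyXi_neq0 (i : 'I_2) : 'X_i != 0 :> poly2.
Proof.
apply/eqP => /(congr1 (dehomogenize i)).
by rewrite rmorph0 dehomogenizeX eqxx => /eqP; rewrite polyX_eq0.
Qed.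

(** On the line where ['X_j] vanishes, ['X_i ^+ k] becomes a power of the variable, hence a
    nonzerodivisor; so [p] vanishes there and one factor ['X_j] cancels at a time. *)
Lemma dvd_mpolyXn (i j : 'I_2) k l (p q : poly2) : i != j ->
  'X_i ^+ k * p = 'X_j ^+ l * q -> exists h, p = 'X_j ^+ l * h.
Proof.
move=> nij; elim: l p => [|l IHl] p E; first by exists p; rewrite mul1r.
have /restrict_axis_eq0[p' Ep]: restrict_axis j p = 0.
  have := congr1 (restrict_axis j) E; rewrite !rmorphM !rmorphXn /=.
  rewrite !restrict_axisX eqxx (negPf nij) expr0n mul0r.
  by move/eqP; rewrite mulf_eq0 expf_eq0 polyX_eq0 andbF => /eqP.
have [|h Eh] := IHl p'; last by exists h; rewrite exprS -mulrA -Eh.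
apply: (mulfI (mpolyXi_neq0 j)); rewrite [RHS]mulrA -exprS -E Ep; ring.
Qed.

(** Coefficients of [u] beyond degree [n] are dropped, whence the size bound in [homogenizeK]. *)
Definition homogenize (i j : 'I_2) n (u : {poly C}) : poly2 :=
  \sum_(k < n.+1) (u`_k)%:MP * ('X_i ^+ k * 'X_j ^+ (n - k)).

Lemma homogenize_homog i j n (u : {poly C}) : homogenize i j n u \is n.-homog.
Proof.
apply: rpred_sum => k _; rewrite mul_mpolyC; apply: rpredZ.
by have := dhomogM (dhomogXn C i k) (dhomogXn C j (n - k)); rewrite subnKC // leq_ord.
Qed.

Lemma homogenizeK i j n (u : {poly C}) : i != j -> (size u <= n.+1)%N ->
  dehomogenize i (homogenize i j n u) = u.
Proof.
move=> nij su; rewrite rmorph_sum /=.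
have {2}-> : u = \poly_(k < n.+1) u`_k.
  apply/polyP => k; rewrite coef_poly; case: ltnP => //.
  by move=> /(leq_trans su)/(nth_default _).
rewrite poly_def; apply: eq_bigr => k _.
rewrite !rmorphM !rmorphXn /= dehomogenizeC !dehomogenizeX eqxx eq_sym.
by rewrite (negPf nij) expr1n mulr1 mul_polyC.
Qed.

Section Coprime.
Variables (d : nat) (F G : poly2).
Hypotheses (homF : F \is d.-homog) (homG : G \is d.-homog).
Hypothesis FG0 : forall z, F.@[z] = 0 -> G.@[z] = 0 -> forall i, z i = 0.

(* Homogenizing a univariate Bezout relation for the dehomogenized forms. *)
Lemma axis_power_ideal2 (j : 'I_2) : exists K, ideal2 F G ('X_j ^+ K).
Proof.
have [i nij] : exists i : 'I_2, i != j.
  by exists (rev_ord j); case: j => [[|[|]]].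
have /Bezout_eq1_coprimepP[[u v] /= uv1] :
    coprimep (dehomogenize i F) (dehomogenize i G).
  (* A common root [t] would give a common zero of [F] and [G] whose coordinate [j] is 1. *)
  apply: Pdiv.ClosedField.root_coprimep => t /rootP Ft; apply/eqP => Gt.
  rewrite !horner_dehomogenize in Ft Gt.
  have /(_ j)/eqP := FG0 Ft Gt.
  by rewrite /= [j == i]eq_sym (negPf nij) oner_eq0.
pose n := maxn (size u) (size v).
pose U := homogenize i j n u; pose V := homogenize i j n v.
exists (n + d)%N, U, V; apply/eqP; rewrite -subr_eq0; apply/eqP.
apply: (@dehomogenize_eq0 _ i (n + d)).
  by rewrite rpredB ?dhomogXn // rpredD // dhomogM // homogenize_homog.
rewrite rmorphB rmorphD !rmorphM rmorphXn /= dehomogenizeX eq_sym (negPf nij).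
rewrite expr1n !homogenizeK // ?uv1 ?subrr //.
  by rewrite leqW // leq_maxr.
by rewrite leqW // leq_maxl.
Qed.

(* If [q = u F + v G] then [q a = G r] and [q b = - F r] with
   [r = v a - u b]; taking powers of both variables for [q], the two values of
   [r] are proportional and their common factor is [h]. *)
Lemma coprime_forms_syzygy (a b : poly2) :
  a * F + b * G = 0 -> exists h, a = h * G /\ b = - (h * F).
Proof.
move=> ab0; have [K [u0 [v0 E0]]] := axis_power_ideal2 ord0.
have [L [u1 [v1 E1]]] := axis_power_ideal2 ord_max.
have ea q r u v : q = u * F + v * G -> r = v * a - u * b -> q * a = G * r.
  move=> -> ->; apply/eqP; rewrite -subr_eq0; apply/eqP.
  by transitivity (u * (a * F + b * G)); [ring | rewrite ab0 mulr0].
have eb q r u v : q = u * F + v * G -> r = v * a - u * b -> q * b = - (F * r).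
  move=> -> ->; apply/eqP; rewrite -subr_eq0; apply/eqP.
  by transitivity (v * (a * F + b * G)); [ring | rewrite ab0 mulr0].
pose w0 := v0 * a - u0 * b; pose w1 := v1 * a - u1 * b.
have [h Eh] : exists h, w1 = 'X_ord_max ^+ L * h.
  apply: (@dvd_mpolyXn ord0 ord_max K L _ w0) => //.
  rewrite {1}E0 mulrDl -!mulrA -(ea _ w1 _ _ E1) // -[F * w1]opprK.
  by rewrite -(eb _ w1 _ _ E1) // /w0; ring.
have XL0 : 'X_ord_max ^+ L != 0 :> poly2 by rewrite expf_neq0 ?mpolyXi_neq0.
exists h; split; apply: (mulfI XL0).
  by rewrite (ea _ w1 _ _ E1) // Eh; ring.
by rewrite (eb _ w1 _ _ E1) // Eh; ring.
Qed.

End Coprime.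

(** * Homogeneous components of elements of the ideal *)

Lemma pihomogMr d k (a F : poly2) : F \is d.-homog ->
  pihomog mdeg k (a * F) =
  if (d <= k)%N then pihomog mdeg (k - d) a * F else 0.
Proof.
move=> homF; elim/mpolyind: a => [|c m p _ _ IH].
  by rewrite mul0r !raddf0 mul0r if_same.
rewrite mulrDl !pihomogD IH -scalerAl !linearZ /= pihomogX.
have homXF : 'X_[m] * F \is (mdeg m + d).-homog by rewrite dhomogM ?dhomogX.
case: leqP => [le_dk|lt_kd].
  rewrite mulrDl; congr (_ + _); have [e|ne] := eqVneq (mdeg m) (k - d)%N.
    by rewrite -scalerAl pihomog_dE // -(subnK le_dk) -e.
  rewrite scaler0 mul0r (pihomog_ne0 _ homXF) ?scaler0 //.
  by apply: contra ne => /eqP <-; rewrite addnK.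
rewrite addr0 (pihomog_ne0 _ homXF) ?scaler0 //.
by rewrite neq_ltn (leq_trans lt_kd) ?orbT // leq_addl.
Qed.

Lemma ideal2_pihomog d k (F G p : poly2) : F \is d.-homog -> G \is d.-homog ->
  ideal2 F G p -> ideal2 F G (pihomog mdeg k p).
Proof.
move=> homF homG [a [b ->]]; rewrite linearD /= !(@pihomogMr d) //.
case: ifP => _; first by exists (pihomog mdeg (k - d) a), (pihomog mdeg (k - d) b).
by rewrite addr0; apply: ideal2_0.
Qed.

(** The component of [a * F + b * G] in a degree below [d] is zero. *)
Lemma ideal2_low_degree d k (F G p : poly2) : F \is d.-homog -> G \is d.-homog ->
  (k < d)%N -> p \is k.-homog -> ideal2 F G p -> p = 0.
Proof.
move=> homF homG ltkd homp [a [b Ep]].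
rewrite -(pihomog_dE homp) Ep linearD /= !(@pihomogMr d) //.
by rewrite leqNgt ltkd addr0.
Qed.

(** * The socle modulo two coprime forms satisfying Euler-type relations *)

Section CompleteIntersection.
Variables (N : nat) (c : C) (F1 F2 G1 G2 F G : poly2).
Hypotheses (homF1 : F1 \is N.-homog) (homF2 : F2 \is N.-homog).
Hypotheses (homG1 : G1 \is N.-homog) (homG2 : G2 \is N.-homog).
Hypotheses (homF : F \is N.+1.-homog) (homG : G \is N.+1.-homog).
Hypothesis c0 : c != 0.
Hypothesis FE : c%:MP * F = 'X_ord0 * F1 + 'X_ord_max * F2.
Hypothesis GE : c%:MP * G = 'X_ord0 * G1 + 'X_ord_max * G2.
Hypothesis FG0 : forall z, F.@[z] = 0 -> G.@[z] = 0 -> forall i, z i = 0.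

Local Notation X := ('X_ord0 : poly2).
Local Notation Y := ('X_ord_max : poly2).
Local Notation I := (ideal2 F G).
Local Notation D := (F1 * G2 - F2 * G1).

Let ideal2_cancel p : I (c%:MP * p) -> I p.
Proof.
have {2}-> : p = c^-1%:MP * (c%:MP * p) by rewrite mulrA -mpolyCM mulVf ?mul1r.
exact: ideal2Ml.
Qed.

(** Cramer's rule for [FE] and [GE], read as a linear system in [X] and [Y] with determinant [D]. In
    the application [F] and [G] are the partial derivatives of [Q], and [D] is the Hessian. *)
Lemma det_mulX0 : I (X * D).
Proof.
apply: ideal2_cancel; exists (c%:MP * c%:MP * G2), (- (c%:MP * c%:MP * F2)).
have -> : X * D = (c%:MP * F) * G2 - (c%:MP * G) * F2 by rewrite FE GE; ring.
by ring.
Qed.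

Lemma det_mulX1 : I (Y * D).
Proof.
apply: ideal2_cancel; exists (- (c%:MP * c%:MP * G1)), (c%:MP * c%:MP * F1).
have -> : Y * D = (c%:MP * G) * F1 - (c%:MP * F) * G1 by rewrite FE GE; ring.
by ring.
Qed.

(** Equating [Y * (X * p)] and [X * (Y * p)] gives a syzygy, which is trivial with factor [h]. Up to
    the scalar [c], Euler's relations make the coefficients of [X * p] congruent to [h * G2] and
    [- (h * F2)] modulo [X]; these main terms contribute [h * (X * D)], and dividing by [X] leaves
    an element of the ideal. *)
Lemma socle_lift p : I (X * p) -> I (Y * p) -> exists h, I (p - h * D).
Proof.
move=> [a [b Xp]] [a' [b' Yp]].
have : (Y * a - X * a') * F + (Y * b - X * b') * G = 0.
  have -> : (Y * a - X * a') * F + (Y * b - X * b') * G =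
    Y * (a * F + b * G) - X * (a' * F + b' * G) by ring.
  by rewrite -Xp -Yp; ring.
move=> /(coprime_forms_syzygy homF homG FG0)[h [Ea Eb]].
(* Multiplying [Ea] by [c] and expanding [c * G] by [GE] gives [Y * (c * a - h * G2) = X * (c * a' +
   h * G1)]. *)
have [t Et] : exists t, c%:MP * a - h * G2 = X ^+ 1 * t.
  apply: (@dvd_mpolyXn ord_max ord0 1 1 _ (c%:MP * a' + h * G1)) => //.
  apply/eqP; rewrite -subr_eq0; apply/eqP.
  have -> : Y ^+ 1 * (c%:MP * a - h * G2) - X ^+ 1 * (c%:MP * a' + h * G1) =
     c%:MP * (Y * a - X * a') - h * (X * G1 + Y * G2) by ring.
  by rewrite Ea -GE; ring.
have [s Es] : exists s, c%:MP * b + h * F2 = X ^+ 1 * s.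
  apply: (@dvd_mpolyXn ord_max ord0 1 1 _ (c%:MP * b' - h * F1)) => //.
  apply/eqP; rewrite -subr_eq0; apply/eqP.
  have -> : Y ^+ 1 * (c%:MP * b + h * F2) - X ^+ 1 * (c%:MP * b' - h * F1) =
     c%:MP * (Y * b - X * b') + h * (X * F1 + Y * F2) by ring.
  by rewrite Eb -FE; ring.
have E : c%:MP * (c%:MP * p) - h * D = c%:MP * t * F + c%:MP * s * G.
  apply: (mulfI (mpolyXi_neq0 ord0)).
  have -> : X * (c%:MP * (c%:MP * p) - h * D) =
      (c%:MP * a) * (c%:MP * F) + (c%:MP * b) * (c%:MP * G) - h * (X * D).
    by rewrite !mulrBr [X * (c%:MP * _)]mulrCA [X * (c%:MP * _)]mulrCA Xp; ring.
  have -> : c%:MP * a = h * G2 + X * t by rewrite -[X]expr1 -Et; ring.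
  have -> : c%:MP * b = - (h * F2) + X * s by rewrite -[X]expr1 -Es; ring.
  transitivity (h * (G2 * (c%:MP * F) - F2 * (c%:MP * G) - X * D) +
    X * (c%:MP * t * F + c%:MP * s * G)); first by ring.
  by rewrite FE GE; ring.
exists (c^-1%:MP * (c^-1%:MP * h)); do 2!apply: ideal2_cancel.
exists (c%:MP * t), (c%:MP * s); rewrite -E !mulrBr !mulrA.
have cK : c%:MP * c^-1%:MP = 1 :> poly2 by rewrite -mpolyCM divff.
by rewrite -[_ * c%:MP * c^-1%:MP]mulrA cK mulr1 cK mul1r.
Qed.

(** Only the constant term of the factor [h] of [socle_lift] survives, since [X * D] and [Y * D] lie
    in the ideal. *)
Lemma socle_lift_const p : I (X * p) -> I (Y * p) ->
  exists l : C, I (p - l *: D).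
Proof.
move=> /socle_lift H /H[h Ih].
have [a [b Eh]] := mpoly2_constE h.
exists h@_0%MM; rewrite -mul_mpolyC.
have -> : p - (h@_0%MM)%:MP * D = (p - h * D) + (a * (X * D) + b * (Y * D)).
  by rewrite {2}Eh; ring.
by apply: ideal2D => //; apply: ideal2D; apply: ideal2Ml;
  [apply: det_mulX0 | apply: det_mulX1].
Qed.

(** If [D = s * F + t * G], comparing [X * D] with Cramer's rule gives a syzygy, trivial with factor
    [u]. On the line [X = 0] it yields [c * F2 = u * F] and [c * G2 = u * G], while Euler gives
    [c * F = Y * F2] and [c * G = Y * G2]. Together these force [F] and [G] to vanish on that line,
    in particular at (0, 1). *)
Lemma det_notin : ~ I D.
Proof.
move=> [s [t ED]].
have E : (c%:MP * G2 - X * s) * F + (- (c%:MP * F2) - X * t) * G = 0.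
  transitivity (G2 * (c%:MP * F) - F2 * (c%:MP * G) - X * (s * F + t * G)).
    by ring.
  by rewrite -ED FE GE; ring.
have [u [Eu Ev]] := coprime_forms_syzygy homF homG FG0 E.
(* The polynomial [c^2 - w * 'X] takes the nonzero value [c^2] at 0, so it can be cancelled. *)
have polyK (q w : {poly C}) : c%:P * (c%:P * q) = w * 'X * q -> q = 0.
  move/eqP; rewrite mulrA -subr_eq0 -mulrBl mulf_eq0 => /orP[/eqP wX|/eqP//].
  have /eqP := congr1 (horner^~ 0) wX.
  by rewrite !hornerE ?mulr0 ?subr0 ?addr0 ?mulf_eq0 ?expf_eq0 (negPf c0).
have rX q : restrict_axis ord0 (X * q) = 0.
  by rewrite rmorphM /= restrict_axisX eqxx mul0r.
have rE q q1 q2 : c%:MP * q = X * q1 + Y * q2 ->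
    c%:P * restrict_axis ord0 q = 'X * restrict_axis ord0 q2.
  move/(congr1 (restrict_axis ord0)); rewrite rmorphD /= rX add0r !rmorphM /=.
  by rewrite restrict_axisC restrict_axisX.
have EF := rE _ _ _ FE; have EG := rE _ _ _ GE.
move: Eu Ev => /(congr1 (restrict_axis ord0)) + /(congr1 (restrict_axis ord0)).
rewrite rmorphN !rmorphB rmorphN /= !rX !subr0 !rmorphM /= restrict_axisC.
move=> Eu /oppr_inj Ev.
have vanish q q2 : c%:P * restrict_axis ord0 q = 'X * restrict_axis ord0 q2 ->
    c%:P * restrict_axis ord0 q2 = restrict_axis ord0 u * restrict_axis ord0 q ->
    q.@[fun k => (k != ord0)%:R] = 0.
  move=> E1 E2; have q20 : restrict_axis ord0 q2 = 0.
    apply: (polyK _ (restrict_axis ord0 u)).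
    by rewrite -mulrA -E1 [RHS]mulrCA -E2.
  have /restrict_axis_eq0[q' ->] : restrict_axis ord0 q = 0.
    have /eqP := E1; rewrite q20 mulr0 mulf_eq0 polyC_eq0 (negPf c0) /=.
    by move/eqP.
  by rewrite mevalM mevalXU mul0r.
have /(_ ord_max)/eqP := FG0 (vanish _ _ EF Ev) (vanish _ _ EG Eu).
by rewrite oner_eq0.
Qed.

Lemma det_homog : D \is (N + N).-homog.
Proof. by rewrite rpredB // dhomogM. Qed.

(** In degree [k] the correction term [l *: D] of [socle_lift_const] has no component, as [D] has
    degree [N + N]. *)
Lemma socle_homog k p : p \is k.-homog -> k != (N + N)%N ->
  I (X * p) -> I (Y * p) -> I p.
Proof.
move=> homp nk /socle_lift_const H /H[l /(ideal2_pihomog k homF homG)].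
rewrite linearB linearZ /= pihomog_dE // (pihomog_ne0 _ det_homog) 1?eq_sym //.
by rewrite scaler0 subr0.
Qed.

(** From degree [K + L] on, every monomial is divisible by [X ^+ K] or [Y ^+ L], both in the ideal.
    Lower degrees follow by descending induction: [X * p] and [Y * p] are already covered, and
    [socle_homog] applies above [N + N]. *)
Lemma ideal2_high_degree k p : (N + N < k)%N -> p \is k.-homog -> I p.
Proof.
have [K IK] := axis_power_ideal2 homF homG FG0 ord0.
have [L IL] := axis_power_ideal2 homF homG FG0 ord_max.
move=> ltNk; have [n] := ubnP (K + L - k)%N.
elim: n => // n IHn in k p ltNk *; rewrite ltnS => le_n homp.
have [leKLk|ltkKL] := leqP (K + L) k.
  rewrite (mpolyE p) big_seq; apply: ideal2_sum => m /(dhomogP _ _ _ homp) /= mk.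
  rewrite -mul_mpolyC; apply: ideal2Ml; rewrite mpolyXE_id big_ord2 /=.
  have := leKLk; rewrite -mk mdegE big_ord2 /=.
  have [leK _|ltK] := leqP K (m ord0).
    by apply: ideal2Mr; rewrite -(subnK leK) exprD; apply: ideal2Ml.
  have [leL _|ltL] := leqP L (m ord_max).
    by apply: ideal2Ml; rewrite -(subnK leL) exprD; apply: ideal2Ml.
  by rewrite leqNgt -addSn leq_add // ltnW.
have step (i : 'I_2) : I ('X_i * p).
  apply: (IHn k.+1); first exact: ltnW.
    by rewrite subnS prednK // subn_gt0.
  by have := dhomogM (dhomogXn C i 1) homp.
by apply: (socle_homog homp); rewrite ?gtn_eqF.
Qed.

(** By [socle_homog], if the products of [p] with all monomials of one positive degree at most [N]
    lie in the ideal, so do those with monomials of degree one less. This descends to [p] itself,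
    whose degree is below that of the generators. *)
Lemma pairing_nondegenerate p : p \is N.-homog ->
  (forall a b, (a + b)%N = N -> I (p * (X ^+ a * Y ^+ b))) -> p = 0.
Proof.
move=> homp Ip; apply: (ideal2_low_degree homF homG (ltnSn N) homp).
(* Here [n] counts the degrees descended: [n = 0] is the hypothesis and [n = N] concerns [p]
   alone. *)
suff H n : (n <= N)%N -> forall a b, (a + b)%N = (N - n)%N -> I (p * (X ^+ a * Y ^+ b)).
  by have := H N (leqnn N) 0%N 0%N; rewrite subnn !mulr1; apply.
elim: n => [_|n IHn ltnN] a b; first by rewrite subn0; apply: Ip.
move=> abE; have homq : p * (X ^+ a * Y ^+ b) \is (N + (N - n.+1)).-homog.
  by rewrite -abE !dhomogM // dhomogXn.
apply: (socle_homog homq).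
- by rewrite eqn_add2l neq_ltn -subn_gt0 subKn.
- have -> : X * (p * (X ^+ a * Y ^+ b)) = p * (X ^+ a.+1 * Y ^+ b).
    by rewrite exprS; ring.
  by apply: IHn; rewrite ?(ltnW ltnN) // addSn abE subnSK.
have -> : Y * (p * (X ^+ a * Y ^+ b)) = p * (X ^+ a * Y ^+ b.+1).
  by rewrite exprS; ring.
by apply: IHn; rewrite ?(ltnW ltnN) // addnS abE subnSK.
Qed.

Lemma ideal2_const0 p : I p -> p@_0%MM = 0.
Proof.
have h0 (q : poly2) : q \is N.+1.-homog -> q@_0%MM = 0.
  by move=> homq; apply: (dhomog_nemf_coeff homq); rewrite /= mdeg0.
move=> [a [b ->]]; rewrite mcoeffD !rmorphM /=.
by rewrite (h0 _ homF) (h0 _ homG) !mulr0 addr0.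
Qed.

(** Writing [p = X * a + Y * b], each term of the binomial expansion contains a monomial of degree
    [2N + 1] in [X] and [Y]. *)
Lemma ideal2_nilpotent p : p@_0%MM = 0 -> I (p ^+ (N + N).+1).
Proof.
move=> p0; have [a [b ->]] := mpoly2_constE p.
rewrite p0 mpolyC0 add0r exprDn; apply: ideal2_sum => i _.
rewrite -mulr_natl !exprMn; apply: ideal2Ml.
have -> (x y z t : poly2) : x * y * (z * t) = (y * t) * (x * z) by ring.
apply: ideal2Ml; apply: (ideal2_high_degree (ltnSn _)).
by have := dhomogM (dhomogXn C ord0 ((N + N).+1 - i)) (dhomogXn C ord_max i);
  rewrite subnK // -ltnS.
Qed.

(** Geometric series: [p] is the nonzero constant [k] minus [k - p], which is nilpotent modulo the
    ideal. *)
Lemma ideal2_unit p : p@_0%MM != 0 -> exists q, I (q * p - 1).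
Proof.
set k := p@_0%MM => k0; set M := (N + N).+1.
have /ideal2_nilpotent : (k%:MP - p)@_0%MM = 0.
  by rewrite mcoeffB mcoeffC eqxx mulr1 subrr.
have := subrXX k%:MP (k%:MP - p) M.
have -> : k%:MP - (k%:MP - p) = p by ring.
set S := \sum_(i < M) _ => E IM.
exists (k^-1%:MP ^+ M * S).
have -> : k^-1%:MP ^+ M * S * p - 1 = - k^-1%:MP ^+ M * (k%:MP - p) ^+ M.
  rewrite -mulrA [S * p]mulrC -E mulrBr -exprMn -mpolyCM mulVf //.
  by rewrite mpolyC1 expr1n addrAC subrr add0r mulNr.
exact: ideal2Ml.
Qed.

End CompleteIntersection.

End BivariateField.

(** * Computing in the Milnor algebra through representatives *)

Section MilnorBridge.
Variables (R : realType) (Q : {mpoly R[i][2]}).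
Local Notation C := R[i].
Local Notation poly2 := {mpoly C[2]}.
Local Notation pi := (milnor_pi Q).

Lemma milnor_pi0 : pi 0 = 0.
Proof. by apply: (addrI (pi 0)); rewrite -milnor_piD !addr0. Qed.

Lemma milnor_pi_mul (p q : poly2) : pi p * pi q = pi (p * q).
Proof. exact: milnor_piM. Qed.

Lemma milnor_pi_exp (p : poly2) n : pi p ^+ n = pi (p ^+ n).
Proof. by elim: n => // n IHn; rewrite !exprS IHn milnor_pi_mul. Qed.

Lemma milnor_pi_scale (k : C) (p : poly2) : k *: pi p = pi (k *: p).
Proof. exact: milnor_piZ. Qed.

Lemma jacobian_idealP (p : poly2) :
  p \in jacobian_ideal Q <-> ideal2 Q^`M(ord0) Q^`M(ord_max) p.
Proof.
split=> [/asboolP[u ->]|[a [b ->]]].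
  by exists (u ord0), (u ord_max); rewrite big_ord2.
apply/asboolP; exists (fun i => if i == ord0 then a else b).
by rewrite big_ord2.
Qed.

Lemma milnor_piE (p q : poly2) :
  pi p = pi q <-> ideal2 Q^`M(ord0) Q^`M(ord_max) (p - q).
Proof. by rewrite milnor_piP; apply: jacobian_idealP. Qed.

Lemma milnor_pi_eq0 (p : poly2) :
  pi p = 0 <-> ideal2 Q^`M(ord0) Q^`M(ord_max) p.
Proof. by rewrite -milnor_pi0 milnor_piE subr0. Qed.

End MilnorBridge.

(** * Derivatives of forms, Euler's identity and the Hessian *)

Lemma dhomog_mderiv (n : nat) (R : idomainType) d (i : 'I_n) (p : {mpoly R[n]}) :
  p \is d.+1.-homog -> p^`M(i) \is d.-homog.
Proof.
move=> /dhomogP homp; apply/dhomogP => m.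
rewrite mcoeff_msupp mcoeff_deriv => nz.
have /homp /= : (m + U_(i))%MM \in msupp p.
  by rewrite mcoeff_msupp; apply: contraNneq nz => ->; rewrite mul0rn.
by rewrite mdegD mdeg1 addn1 => -[].
Qed.

Lemma mpoly_euler (n : nat) (R : comNzRingType) d (p : {mpoly R[n]}) :
  p \is d.-homog -> \sum_(i < n) 'X_i * p^`M(i) = d%:R *: p.
Proof.
move=> /dhomogP homp; rewrite {2}(mpolyE p) scaler_sumr.
under eq_bigr => i _ do rewrite {1}(mpolyE p) raddf_sum mulr_sumr.
rewrite exchange_big /= big_seq [RHS]big_seq; apply: eq_bigr => m /homp /= <-.
rewrite mdegE natr_sum scaler_suml; apply: eq_bigr => i _.
rewrite mderivZ mderivX -!scalerAr scalerA [RHS]scalerA mulrC.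
(* For exponent zero the truncated [m - U_(i)] does not recover [m], but the coefficient
   vanishes. *)
case: (posnP (m i)) => [->|mi]; first by rewrite mul0r !scale0r.
by rewrite -mpolyXD addmC submK // lep1mP -lt0n.
Qed.

Lemma hessian2E (R : realType) (Q : {mpoly R[i][2]}) :
  hessian Q = Q^`M(ord0)^`M(ord0) * Q^`M(ord_max)^`M(ord_max) -
              Q^`M(ord0)^`M(ord_max) * Q^`M(ord_max)^`M(ord0).
Proof.
rewrite /hessian (expand_det_row _ ord0) big_ord2 /= /cofactor !det_mx11 !mxE.
have e0 : lift (ord0 : 'I_2) 0 = ord_max by apply: val_inj.
have e1 : lift (ord_max : 'I_2) 0 = ord0 by apply: val_inj.
by rewrite !e0 !e1 /= expr0 expr1 mul1r mulN1r mulrN.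
Qed.

(** * The maximal ideal and the socle of the Milnor algebra of a form of degree [N + 2] *)

Section SocleIso.
Variables (R : realType) (N : nat) (Q : {mpoly R[i][2]}).
Local Notation C := R[i].
Local Notation poly2 := {mpoly C[2]}.
Local Notation pi := (milnor_pi Q).
Local Notation X := ('X_ord0 : poly2).
Local Notation Y := ('X_ord_max : poly2).
Local Notation I := (ideal2 Q^`M(ord0) Q^`M(ord_max)).
Hypothesis N_gt0 : (0 < N)%N.
Hypothesis homQ : Q \is N.+2.-homog.
Hypothesis Qnd : forall z : 'I_2 -> C, (forall i, (Q^`M(i)).@[z] = 0) ->
  forall i, z i = 0.

Let c : C := N.+1%:R.

Let c0 : c != 0.
Proof. by rewrite pnatr_eq0. Qed.

Let homQ1 i : Q^`M(i) \is N.+1.-homog.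
Proof. exact: dhomog_mderiv. Qed.

Let homQ2 i j : Q^`M(i)^`M(j) \is N.-homog.
Proof. exact: dhomog_mderiv. Qed.

Let euler i : c%:MP * Q^`M(i) = X * Q^`M(i)^`M(ord0) + Y * Q^`M(i)^`M(ord_max).
Proof. by rewrite mul_mpolyC -mpoly_euler // big_ord2. Qed.

Let Qnd2 (z : 'I_2 -> C) : (Q^`M(ord0)).@[z] = 0 -> (Q^`M(ord_max)).@[z] = 0 ->
  forall i, z i = 0.
Proof.
move=> z0 z1; apply: Qnd => i.
by have [->|->] := @ord2_cases ord0 ord_max i isT.
Qed.

Lemma hessian_notin : ~ I (hessian Q).
Proof.
rewrite hessian2E.
exact: (det_notin (homQ1 ord0) (homQ1 ord_max) c0 (euler _) (euler _) Qnd2).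
Qed.

Lemma hessian_mulX i : I ('X_i * hessian Q).
Proof.
rewrite hessian2E; have [->|->] := @ord2_cases ord0 ord_max i isT.
  exact: (det_mulX0 c0 (euler _) (euler _)).
exact: (det_mulX1 c0 (euler _) (euler _)).
Qed.

Lemma jacobian_socle p : (forall i, I ('X_i * p)) ->
  exists l : C, I (p - l *: hessian Q).
Proof.
move=> Ip; rewrite hessian2E.
exact: (socle_lift_const (homQ1 ord0) (homQ1 ord_max) c0 (euler _) (euler _) Qnd2).
Qed.

Lemma jacobian_high_degree k p : (2 * N < k)%N -> p \is k.-homog -> I p.
Proof.
rewrite mul2n -addnn.
exact: (ideal2_high_degree (homQ2 _ _) (homQ2 _ _) (homQ2 _ _) (homQ2 _ _)
  (homQ1 _) (homQ1 _) c0 (euler _) (euler _) Qnd2).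
Qed.

Lemma jacobian_pairing p : p \is N.-homog ->
  (forall a b, (a + b)%N = N -> I (p * (X ^+ a * Y ^+ b))) -> p = 0.
Proof.
exact: (pairing_nondegenerate (homQ2 _ _) (homQ2 _ _) (homQ2 _ _) (homQ2 _ _)
  (homQ1 _) (homQ1 _) c0 (euler _) (euler _) Qnd2).
Qed.

Lemma jacobian_const0 p : I p -> p@_0%MM = 0.
Proof. exact: (ideal2_const0 (homQ1 _) (homQ1 _)). Qed.

Lemma jacobian_unit p : p@_0%MM != 0 -> exists q, I (q * p - 1).
Proof.
exact: (ideal2_unit (homQ2 _ _) (homQ2 _ _) (homQ2 _ _) (homQ2 _ _)
  (homQ1 _) (homQ1 _) c0 (euler _) (euler _) Qnd2).
Qed.

Lemma milnor_unit p : p@_0%MM != 0 -> exists y, y * pi p = 1.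
Proof.
by move=> /jacobian_unit[q Iq]; exists (pi q); rewrite milnor_pi_mul; apply/milnor_piE.
Qed.

Let maxI : set (milnor Q) :=
  [set x | exists2 p : poly2, p@_0%MM = 0 & x = pi p]%classic.

Let maxI_pi p : maxI (pi p) <-> p@_0%MM = 0.
Proof.
split=> [[q q0 /milnor_piE/jacobian_const0]|p0]; last by exists p.
by rewrite mcoeffB q0 subr0.
Qed.

Let ideal_unit (J : set (milnor Q)) x y : is_ideal J -> J x -> y * x = 1 -> J = setT.
Proof.
move=> [_ _ JM] Jx yx1; apply/seteqP; split=> // z _.
by rewrite -[z]mulr1 -yx1; do 2!apply: (JM).
Qed.

Let maxI_ideal : is_ideal maxI.
Proof.
split=> [|_ _ [p p0 ->] [q q0 ->]|a _ [p p0 ->]].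
- by exists 0; rewrite ?mcoeff0 ?milnor_pi0.
- by exists (p + q); rewrite ?milnor_piD // mcoeffD p0 q0 addr0.
rewrite -(milnor_reprK a) milnor_pi_mul; apply/maxI_pi.
by rewrite rmorphM /= p0 mulr0.
Qed.

Let maxI_proper : maxI <> setT.
Proof.
move=> E; have /maxI_pi/eqP : maxI (pi 1) by rewrite E.
by rewrite mcoeff1 eqxx oner_eq0.
Qed.

(** An element outside [maxI] has a representative with nonzero constant term and is therefore a
    unit: the algebra is local. *)
Let sub_maxI (J : set (milnor Q)) : is_ideal J -> J <> setT -> (J `<=` maxI)%classic.
Proof.
move=> idJ JT x Jx; rewrite -(milnor_reprK x); apply/maxI_pi/eqP.
apply/negPn/negP => /milnor_unit[y]; rewrite milnor_reprK => yx.
exact/JT/(ideal_unit idJ Jx yx).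
Qed.

(** Maximality of [maxI] shows that the choice in [maximal_ideal] does not fall back to its default;
    the chosen ideal is contained in [maxI], hence equal to it. *)
Lemma milnor_maximal_idealE : @maximal_ideal (milnor Q) = maxI.
Proof.
have max_maxI : is_maximal_ideal maxI.
  split=> // J idJ leJ; have [->|JT] := pselect (J = setT); [by right | left].
  by apply/seteqP; split=> //; apply: sub_maxI.
have [idM MT Mmax] : is_maximal_ideal (@maximal_ideal (milnor Q)).
  by apply: xgetPex; exists maxI.
by have [] := Mmax _ maxI_ideal (sub_maxI idM MT).
Qed.

Lemma milnor_soclePi p :
  socle (pi p) <-> p@_0%MM = 0 /\ forall i, I ('X_i * p).
Proof.
rewrite /socle /= milnor_maximal_idealE maxI_pi; split=> -[p0 H]; split=> //.
  move=> i; apply/milnor_pi_eq0; rewrite mulrC -milnor_pi_mul; apply: H.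
  by exists 'X_i; rewrite // mcoeffX mnm1_eq0.
move=> _ [q q0 ->]; rewrite milnor_pi_mul; apply/milnor_pi_eq0.
have [a [b ->]] := mpoly2_constE q; rewrite q0 mpolyC0.
have -> : p * (0 + X * a + Y * b) = a * (X * p) + b * (Y * p) by ring.
by apply: ideal2D; apply: ideal2Ml.
Qed.

(** Positivity of [N] matters: a Hessian of degree 0 would be a constant, and a nonzero one lies
    outside the maximal ideal. *)
Lemma hessian_const0 : (hessian Q)@_0%MM = 0.
Proof.
have hom : hessian Q \is (N + N).-homog.
  by rewrite hessian2E; apply: det_homog.
by rewrite (dhomog_nemf_coeff hom) //= mdeg0 eq_sym addn_eq0 andbb -lt0n.
Qed.

Lemma milnor_socleE (x : milnor Q) : socle x <-> exists l : C, x = l *: pi (hessian Q).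
Proof.
rewrite -(milnor_reprK x); split=> [/milnor_soclePi[_ /jacobian_socle[l Il]]|[l ->]].
  by exists l; rewrite milnor_pi_scale; apply/milnor_piE.
rewrite milnor_pi_scale; apply/milnor_soclePi; split.
  by rewrite mcoeffZ hessian_const0 mulr0.
by move=> i; rewrite -scalerAr -mul_mpolyC; apply/ideal2Ml/hessian_mulX.
Qed.

Lemma socle_iso_spec : is_socle_iso (@socle_iso R Q).
Proof.
apply: xgetPex.
have e0 : pi (hessian Q) != 0 by apply/eqP => /milnor_pi_eq0; apply: hessian_notin.
(* The coordinate with respect to the class of the Hessian, with junk value 0 off the socle; [e0]
   makes it unique. *)
pose w (x : milnor Q) : C := xget 0 [set l | x = l *: pi (hessian Q)]%classic.
have wE l : w (l *: pi (hessian Q)) = l.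
  have /eqP : l *: pi (hessian Q) = w (l *: pi (hessian Q)) *: pi (hessian Q).
    by apply: (@xgetPex C 0 [set k | _ = k *: _]%classic); exists l.
  rewrite -subr_eq0 -scalerBl scaler_eq0 (negPf e0) orbF subr_eq0 eq_sym.
  by move/eqP.
exists w; split.
- move=> k x y /milnor_socleE[l ->] /milnor_socleE[l' ->].
  by rewrite scalerA -scalerDl !wE.
- split=> // [x y|l _].
    by move=> /set_mem/milnor_socleE[l ->] /set_mem/milnor_socleE[l' ->];
      rewrite !wE => ->.
  by exists (l *: pi (hessian Q)) => //; apply/milnor_socleE; exists l.
by rewrite -[pi _]scale1r wE.
Qed.

Local Notation w := (@socle_iso R Q).

Lemma socle_homog2N p : p \is (2 * N).-homog -> socle (pi p).
Proof.
move=> homp; apply/milnor_soclePi; split.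
  apply: (dhomog_nemf_coeff homp); rewrite /= mdeg0 eq_sym.
  by rewrite muln_eq0 /= -lt0n.
move=> i; apply: (jacobian_high_degree (ltnSn _)).
by have := dhomogM (dhomogXn C i 1) homp.
Qed.

Lemma socle_iso0 : w 0 = 0.
Proof.
have [lin _ _] := socle_iso_spec.
have s0 : socle (0 : milnor Q).
  by apply/milnor_socleE; exists 0; rewrite scale0r.
have := lin 1 0 0 s0 s0; rewrite scaler0 addr0 mul1r => E.
by apply: (addrI (w 0)); rewrite addr0 -E.
Qed.

Lemma socle_iso_eq0 p : p \is (2 * N).-homog -> w (pi p) = 0 -> I p.
Proof.
move=> homp wp; apply/milnor_pi_eq0.
have [_ [_ inj _] _] := socle_iso_spec.
apply: inj; rewrite ?socle_iso0 //; apply/mem_set; first exact: socle_homog2N.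
by apply/milnor_socleE; exists 0; rewrite scale0r.
Qed.

(** The map [w] is known to be linear on the socle only, so every summand has to be a form of degree
    [2 * N]. *)
Lemma socle_iso_sum n (k : 'I_n -> C) (f : 'I_n -> poly2) :
  (forall i, f i \is (2 * N).-homog) ->
  w (pi (\sum_(i < n) k i *: f i)) = \sum_(i < n) k i * w (pi (f i)).
Proof.
have [lin _ _] := socle_iso_spec.
elim: n k f => [|n IHn] k f homf; first by rewrite !big_ord0 milnor_pi0 socle_iso0.
rewrite !big_ord_recl milnor_piD -milnor_pi_scale lin.
- by rewrite (IHn (fun i => k (lift ord0 i)) (fun i => f (lift ord0 i))).
- exact: socle_homog2N.
by apply/socle_homog2N/rpred_sum => i _; apply: rpredZ.
Qed.

(** * The associated form in coordinates and its catalecticant *)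

Definition assoc_coef j : C := w (pi (X ^+ (2 * N - j) * Y ^+ j)).

Definition assoc_form_explicit : poly2 :=
  \sum_(j < (2 * N).+1)
    (assoc_coef j *+ 'C(2 * N, j)) *: (X ^+ (2 * N - j) * Y ^+ j).

Lemma assoc_form_explicit_homog : assoc_form_explicit \is (2 * N).-homog.
Proof.
by apply: rpred_sum => j _; apply: rpredZ; apply: dhomog_XY; rewrite -ltnS.
Qed.

(** The binomial theorem is applied to representatives before the quotient map, and [w] is then
    distributed over the expansion. *)
Lemma assoc_form_explicitP : is_associated_form N.+2 Q assoc_form_explicit.
Proof.
rewrite /is_associated_form !subSS subn0; split; first exact: assoc_form_explicit_homog.
move=> z; rewrite big_ord2 /= !milnor_pi_scale -milnor_piD milnor_pi_exp exprDn.
rewrite raddf_sum /=.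
under [in RHS]eq_bigr => j _.
  rewrite !exprZn -scalerAl -scalerAr scalerA -scaler_nat scalerA.
  over.
rewrite socle_iso_sum => [|j]; last by apply: dhomog_XY; rewrite -ltnS.
apply: eq_bigr => j _; rewrite mevalZ mevalM !rmorphXn /= !mevalXU.
by rewrite -[assoc_coef j *+ _]mulr_natl mulrAC.
Qed.

(** Two forms of the same degree with equal values agree: their dehomogenized difference has every
    scalar as a root. *)
Lemma associated_formE : associated_form N.+2 Q = assoc_form_explicit.
Proof.
have [homP PE] : is_associated_form N.+2 Q (associated_form N.+2 Q).
  by apply: xgetPex; exists assoc_form_explicit; apply: assoc_form_explicitP.
have [homP' PE'] := assoc_form_explicitP.
apply/eqP; rewrite -subr_eq0; apply/eqP.
apply: (@dehomogenize_eq0 _ ord0 (2 * (N.+2 - 2))); first exact: rpredB.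
apply/eqP/negPn/negP => /closed_nonrootP[t /negP]; apply; apply/rootP.
by rewrite horner_dehomogenize mevalB PE PE' subrr.
Qed.

Lemma catalecticant_matrixE (i j : 'I_N.+1) :
  (associated_form N.+2 Q)@_(U_(ord0) *+ (2 * N - (i + j)) + U_(ord_max) *+ (i + j))%MM
    / 'C(2 * N, i + j)%:R = assoc_coef (i + j).
Proof.
have le : (i + j <= 2 * N)%N by rewrite mul2n -addnn leq_add // -ltnS.
rewrite associated_formE.
rewrite (mcoeff_sumXY (fun k => assoc_coef k *+ 'C(2 * N, k)) le).
by rewrite -[assoc_coef _ *+ _]mulr_natr mulfK // pnatr_eq0 -lt0n bin_gt0.
Qed.

(** A kernel vector [v] of the matrix is read as the coefficients of a form [p] of degree [N]. Entry
    [b] of [v] times the matrix is the value of [w] on [p * X ^+ (N - b) * Y ^+ b], so [p] is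
    orthogonal to all monomials of degree [N] and vanishes. *)
Lemma catalecticant_associated_neq0 :
  catalecticant N (associated_form N.+2 Q) != 0.
Proof.
apply/negP => /det0P[v v0 vA].
(* Extension of [v] by 0 to all naturals, the index type of [mcoeff_sumXY]. *)
pose f k := if insub k is Some i then v 0 i else 0 : C.
have fE (i : 'I_N.+1) : f i = v 0 i by rewrite /f valK.
pose p := \sum_(k < N.+1) f k *: (X ^+ (N - k) * Y ^+ k).
have homp : p \is N.-homog.
  by apply: rpred_sum => k _; apply: rpredZ; apply: dhomog_XY; rewrite -ltnS.
case/eqP: v0; apply/rowP => i; rewrite mxE -fE -(mcoeff_sumXY f (leq_ord i)) -/p.
suff -> : p = 0 by rewrite mcoeff0.
apply: (jacobian_pairing homp) => a b ab.
have ltb : (b < N.+1)%N by rewrite ltnS -ab leq_addl.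
apply: socle_iso_eq0.
  have := dhomogM homp (dhomogM (dhomogXn C ord0 a) (dhomogXn C ord_max b)).
  by rewrite ab addnn -mul2n.
rewrite mulr_suml; under eq_bigr => k _ do rewrite -scalerAl.
have E (k : 'I_N.+1) : X ^+ (N - k) * Y ^+ k * (X ^+ a * Y ^+ b) =
    X ^+ (2 * N - (k + b)) * Y ^+ (k + b).
  have -> : (2 * N - (k + b) = (N - k) + a)%N.
    by have := leq_ord k; lia.
  by rewrite !exprD; ring.
rewrite socle_iso_sum => [|k]; last first.
  rewrite E; apply: dhomog_XY; rewrite mul2n -addnn leq_add //.
  by rewrite leq_ord.
have := congr1 (fun M : 'rV_N.+1 => M 0 (Ordinal ltb)) vA; rewrite !mxE => vAb.
rewrite -[RHS]vAb; apply: eq_bigr => k _.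
by rewrite mxE fE catalecticant_matrixE E.
Qed.

End SocleIso.

Theorem proposition5p1 (R : realType) (m : nat) (Q : {mpoly R[i][2]}) :
  (3 <= m)%N -> nondegenerate_form m Q ->
  catalecticant (m - 2) (associated_form m Q) != 0.
Proof.
(* Here [m] is [N.+3], so the preceding results apply with [N.+1], which is positive. *)
case: m => [|[|[|N]]] // _ [homQ Qnd]; rewrite !subSS subn0.
exact: catalecticant_associated_neq0.
Qed.
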